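(* Let $p$ be an odd prime, $q$ a power of $p$, $\xi$ a generator of $\mathbb F_q^*$, $\ell$ an odd prime with $\ell\ne p$ and $\ell\mid q-1$, and $m,n$ positive integers. Let $u$ be such that $\ell^u$ exactly divides $q-1$, $v=\min\{m,u\}$ and $\zeta=\xi^{(q-1)/\ell^v}$. Let $\lambda\in\mathbb F_q^*$ and let $C$ be a $\lambda$-constacyclic code of length $2\ell^mp^n$ over $\mathbb F_q$. Then one of the following holds (empty products are $1$). (I) $\lambda\in\langle\xi^{2\ell^v}\rangle$. Then $c_1^{2\ell^mp^n}\lambda=1$ for some $c_1\in\mathbb F_q^*$, and $$C=\Big\langle\prod_{i=0}^{\ell^v-1}(X-c_1^{-1}\zeta^i)^{\varepsilon_i}(X+c_1^{-1}\zeta^i)^{\epsilon_i}\cdot\prod_{j=1}^{m-u}\prod_{\substack{k=1\\ \ell\nmid k}}^{\ell^v}(X^{\ell^j}-c_1^{-\ell^j}\zeta^k)^{\tau_k^j}(X^{\ell^j}+c_1^{-\ell^j}\zeta^k)^{\sigma_k^j}\Big\rangle$$ for some integers $0\le\varepsilon_i,\epsilon_i,\tau_k^j,\sigma_k^j\le p^n$. (II) $\lambda\in\xi^{\ell^vp^n}\langle\xi^{2\ell^v}\rangle$. Then $c_2^{2\ell^mp^n}\lambda=\xi^{\ell^vp^n}$ for some $c_2\in\mathbb F_q^*$, and: (II.A) if $m\le u$, then $C=\big\langle\prod_{i=0}^{\ell^m-1}(X^2-c_2^{-2}\xi\alpha^i)^{\varepsilon_i}\big\rangle$ for some integers $0\le\varepsilon_i\le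 p^n$, where $\alpha=\xi^{(q-1)/\ell^m}$; (II.B) if $m>u$, then $$C=\Big\langle\prod_{i=0}^{\ell^u-1}(X^2-c_2^{-2}\beta^{-1}\zeta^i)^{\varepsilon_i}\cdot\prod_{j=1}^{m-u}\prod_{\substack{k=1\\ \ell\nmid k}}^{\ell^u}(X^{2\ell^j}-c_2^{-2\ell^j}\beta^{-\ell^j}\zeta^k)^{\sigma_k^j}\Big\rangle$$ for some integers $0\le\varepsilon_i,\sigma_k^j\le p^n$, where $\beta$ is the element of $\langle\xi^{\ell^u}\rangle$ with $\beta^{\ell^m}\xi^{\ell^u}=1$. (III) $\lambda\in\xi^{jp^n}\langle\xi^{2\ell^v}\rangle$ for some $1\le j\le 2\ell^v-1$ with $j\ne\ell^v$. Then $d_1^{2\ell^mp^n}\lambda=\xi^{jp^n}$ for some $d_1\in\mathbb F_q^*$; write $j=y\ell^z$ with $\gcd(y,\ell)=1$, $0\le z\le v-1$, and let $\delta=\xi^{(q-1)/\ell^z}$. Then: (III.A) if $y$ is odd, $C=\big\langle\prod_{i=0}^{\ell^z-1}(X^{2\ell^{m-z}}-d_1^{-2\ell^{m-z}}\delta^i\xi^y)^{\varepsilon_i}\big\rangle$ for some integers $0\le\varepsilon_i\le p^n$; (III.B) if $y=2y_0$ is even, $C=\big\langle\prod_{i=0}^{\ell^z-1}(X^{\ell^{m-z}}-d_1^{-\ell^{m-z}}\delta^i\xi^{y_0})^{\varepsilon_i}(X^{\ell^{m-z}}+d_1^{-\ell^{m-z}}\delta^i\xi^{y_0})^{\epsilon_i}\big\rangle$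 for some integers $0\le\varepsilon_i,\epsilon_i\le p^n$.
   Context: For $\mu\in\mathbb F_q^*$, a $\mu$-constacyclic code of length $N$ over $\mathbb F_q$ is a linear subspace of $\mathbb F_q^N$ closed under $(c_0,\dots,c_{N-1})\mapsto(\mu c_{N-1},c_0,\dots,c_{N-2})$; such codes are identified with ideals of $\mathbb F_q[X]/\langle X^N-\mu\rangle$, and $\langle g(X)\rangle$ denotes the ideal generated by the image of $g(X)$. $\langle\xi^k\rangle$ denotes the subgroup of $\mathbb F_q^*$ generated by $\xi^k$, and $\xi^s\langle\xi^k\rangle$ its coset. *)

(* Defs.v *)
From HB Require Import structures.
From mathcomp Require Import all_boot all_order all_algebra.
Set Implicit Arguments. Unset Strict Implicit. Unset Printing Implicit Defensive.
Import GRing.Theory.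
Local Open Scope ring_scope.

Section ConstacyclicCodes.
Variable F : fieldType.

(* k-th coordinate of a word c in F^N (0 if k >= N). *)
Definition cw N (c : 'rV[F]_N) (k : nat) : F :=
  if insub k is Some i then c 0 i else 0.

Definition constashift N (lam : F) (c : 'rV[F]_N) : 'rV[F]_N :=
  \row_(i < N) (if val i == 0%N then lam * cw c N.-1 else cw c (val i).-1).

Definition is_constacyclic N (lam : F) (C : {vspace 'rV[F]_N}) : Prop :=
  forall c, c \in C -> constashift lam c \in C.

Definition cw_poly N (c : 'rV[F]_N) : {poly F} := \sum_(i < N) c 0 i *: 'X^i.

(* C = <g> as an ideal of F[X]/<X^N - lam>: the codewords are exactly the
   (reduced representatives of the) multiples of g modulo X^N - lam. *)
Definition code_generated N (lam : F) (C : {vspace 'rV[F]_N}) (g : {poly F}) : Prop :=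
  forall c : 'rV[F]_N,
    c \in C <-> exists h : {poly F}, cw_poly c = (g * h) %% ('X^N - lam%:P).

Definition in_coset (xi : F) (s k : nat) (lam : F) : Prop :=
  exists t : nat, lam = xi ^+ (s + k * t).

Definition genI (l v m u : nat) (c1 zeta : F) (eps eps' : nat -> nat)
  (tau sig : nat -> nat -> nat) : {poly F} :=
  (\prod_(i < (l ^ v)%N)
     (('X - (c1^-1 * zeta ^+ i)%:P) ^+ eps i * ('X + (c1^-1 * zeta ^+ i)%:P) ^+ eps' i))
  * \prod_(1 <= j < (m - u).+1) \prod_(1 <= k < (l ^ v)%N.+1 | ~~ (l %| k)%N)
     (('X^(l ^ j)%N - (c1 ^- (l ^ j)%N * zeta ^+ k)%:P) ^+ tau j k
      * ('X^(l ^ j)%N + (c1 ^- (l ^ j)%N * zeta ^+ k)%:P) ^+ sig j k).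

Definition genIIA (l m : nat) (c2 xi alpha : F) (eps : nat -> nat) : {poly F} :=
  \prod_(i < (l ^ m)%N) ('X^2 - (c2 ^- 2 * xi * alpha ^+ i)%:P) ^+ eps i.

Definition genIIB (l m u : nat) (c2 beta zeta : F) (eps : nat -> nat)
  (sig : nat -> nat -> nat) : {poly F} :=
  (\prod_(i < (l ^ u)%N) ('X^2 - (c2 ^- 2 * beta^-1 * zeta ^+ i)%:P) ^+ eps i)
  * \prod_(1 <= j < (m - u).+1) \prod_(1 <= k < (l ^ u)%N.+1 | ~~ (l %| k)%N)
     ('X^(2 * l ^ j)%N - (c2 ^- (2 * l ^ j)%N * beta ^- (l ^ j)%N * zeta ^+ k)%:P) ^+ sig j k.

Definition genIIIA (l m z y : nat) (d1 delta xi : F) (eps : nat -> nat) : {poly F} :=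
  \prod_(i < (l ^ z)%N)
    ('X^(2 * l ^ (m - z))%N - (d1 ^- (2 * l ^ (m - z))%N * delta ^+ i * xi ^+ y)%:P) ^+ eps i.

Definition genIIIB (l m z y0 : nat) (d1 delta xi : F) (eps eps' : nat -> nat) : {poly F} :=
  \prod_(i < (l ^ z)%N)
    (('X^(l ^ (m - z))%N - (d1 ^- (l ^ (m - z))%N * delta ^+ i * xi ^+ y0)%:P) ^+ eps i
     * ('X^(l ^ (m - z))%N + (d1 ^- (l ^ (m - z))%N * delta ^+ i * xi ^+ y0)%:P) ^+ eps' i).

End ConstacyclicCodes.

(* Main.v *)
(* An ideal of F[X]/(X^N - lam) is generated by a divisor of X^N - lam, and since
   the characteristic is p, X^N - lam = (X^(2 l^m) - mu)^(p^n) where mu^(p^n) = lam.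
   It remains to split X^(2 l^m) - mu into irreducible factors: then every divisor
   of its p^n-th power is, up to a scalar, a product of powers of these factors with
   exponents at most p^n.  After rescaling X so that mu becomes a power of xi, the
   factors are read off from the l-power roots of unity contained in F.  They are
   binomials X^k - a with 4 not dividing k, which are irreducible because a is not
   an r-th power for any prime r dividing k: a root of X^k - a in an extension of
   degree d forces k to divide 1 + q + ... + q^(d-1), hence k to divide d. *)
Require Import Defs.
From HB Require Import structures.
From mathcomp Require Import all_boot all_order all_algebra all_field.
From mathcomp Require Import zify ring.
Import GRing.Theory.
Set Implicit Arguments.
Unset Strict Implicit.
Local Open Scope ring_scope.

(** * Divisibility of the sums 1 + q + ... + q^(d-1) *)

Section GeometricSums.
Local Open Scope nat_scope.
Implicit Types q r d e k n t : nat.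

Lemma sum_expn_mod q r d : q = 1 %[mod r] -> \sum_(i < d) q ^ i = d %[mod r].
Proof.
move=> q1; elim: d => [|d IHd]; first by rewrite big_ord0.
rewrite big_ord_recr /= -modnDm IHd -(modnXm d r q) q1 modnXm exp1n modnDm.
by rewrite addn1.
Qed.

(** Group the exponents into e consecutive blocks of length d. This lets an induction trade q for a
    power of q. *)
Lemma sum_expnM q d e :
  \sum_(i < d * e) q ^ i = (\sum_(i < d) q ^ i) * \sum_(i < e) (q ^ d) ^ i.
Proof.
elim: e => [|e IHe]; first by rewrite muln0 !big_ord0 muln0.
rewrite mulnS addnC big_split_ord /= IHe big_ord_recr /= mulnDr; congr (_ + _).
rewrite big_distrl /=; apply: eq_bigr => i _.
by rewrite expnD -expnM mulnC.
Qed.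

Lemma expn_modSn_sq r t i : (1 + r * t) ^ i = 1 + i * (r * t) %[mod r ^ 2].
Proof.
elim: i => [|i IHi]; first by rewrite mul0n addn0.
rewrite expnS -modnMmr IHi modnMmr.
have -> : (1 + r * t) * (1 + i * (r * t)) = (i * t ^ 2) * r ^ 2 + (1 + i.+1 * (r * t)).
  by lia.
by rewrite modnMDl.
Qed.

(** Writing q = 1 + r t, the sum is r + C(r,2) r t modulo r^2, and r divides C(r,2) because r is
    odd. *)
Lemma sum_expn_prime_mod q r : odd r -> q = 1 %[mod r] -> 0 < q ->
  \sum_(i < r) q ^ i = r %[mod r ^ 2].
Proof.
move=> odd_r q1 q_gt0.
have [t ->] : exists t, q = 1 + r * t.
  have /dvdnP[t tE] : r %| q - 1 by rewrite -eqn_mod_dvd // q1.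
  by exists t; lia.
have H k : \sum_(i < k) (1 + r * t) ^ i = k + 'C(k, 2) * (r * t) %[mod r ^ 2].
  elim: k => [|k IHk]; first by rewrite big_ord0.
  rewrite big_ord_recr /= -modnDm IHk expn_modSn_sq modnDm binS bin1.
  by congr (_ %% _); lia.
rewrite H bin2odd //.
have -> : r + r * r.-1./2 * (r * t) = (r.-1./2 * t) * r ^ 2 + r by lia.
by rewrite modnMDl.
Qed.

(** Modulo r the sum is d, so d = r e. The sum then factors as the sum of length r for q times the
    sum of length e for q^r. The first factor contains r exactly once, and induction on k treats the
    second. *)
Lemma prime_power_dvd_sum_expn q r k d : prime r -> odd r ->
  q = 1 %[mod r] -> 0 < q -> r ^ k %| \sum_(i < d) q ^ i -> r ^ k %| d.
Proof.
move=> r_pr odd_r; elim: k q d => [|k IHk] q d q1 q_gt0; first by rewrite !dvd1n.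
move=> dvS; have r_gt0 := prime_gt0 r_pr.
have /dvdnP[e dE] : r %| d.
  rewrite /dvdn -(sum_expn_mod d q1) -/(dvdn _ _).
  by apply: dvdn_trans dvS; rewrite expnS dvdn_mulr.
move: dvS; rewrite dE mulnC sum_expnM expnS dvdn_pmul2l //.
have S_mod := sum_expn_prime_mod odd_r q1 q_gt0.
have /dvdnP[s sE] : r %| \sum_(i < r) q ^ i.
  by rewrite /dvdn (sum_expn_mod _ q1) modnn.
have cop : coprime r s.
  rewrite prime_coprime //; apply/negP => /dvdnP[s' s'E].
  have : \sum_(i < r) q ^ i = 0 %[mod r ^ 2].
    by rewrite sE s'E -mulnA mulnn modnMl mod0n.
  rewrite S_mod mod0n => /eqP; apply/negP; rewrite -/(dvdn _ _).
  by rewrite gtnNdvd // -mulnn ltn_Pmull ?prime_gt1.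
rewrite sE [s * r]mulnC -mulnA dvdn_pmul2l // Gauss_dvdr ?coprimeXl //.
by apply: IHk; rewrite ?expn_gt0 ?q_gt0 // -modnXm q1 modnXm exp1n.
Qed.

(* For r = 2 the exponent of r in the geometric sum may exceed that of r in d
   (q = 3, d = 2), hence the restriction on n. *)
Lemma dvd_sum_expn q n d : 0 < n -> ~~ (4 %| n) -> 0 < q ->
  (forall r, prime r -> r %| n -> q = 1 %[mod r]) ->
  n %| \sum_(i < d) q ^ i -> n %| d.
Proof.
move=> n_gt0 n4 q_gt0 q1 dvS; apply/dvdn_partP => // r.
rewrite mem_primes => /and3P[r_pr _ r_n]; rewrite p_part.
have dvr : r ^ logn r n %| \sum_(i < d) q ^ i.
  exact: dvdn_trans (pfactor_dvdnn _ _) dvS.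
(* For r = 2 the exponent in n is at most 1, so reduction modulo 2 suffices. *)
have [r2|odd_r] := even_prime r_pr; last first.
  exact: prime_power_dvd_sum_expn (q1 _ r_pr r_n) q_gt0 dvr.
have r2n : logn r n <= 1.
  by rewrite leqNgt -pfactor_dvdn // r2.
apply: dvdn_trans (dvdn_exp2l r r2n) _; rewrite expn1.
rewrite /dvdn -(sum_expn_mod d (q1 _ r_pr r_n)) -/(dvdn _ _).
exact: dvdn_trans r_n dvS.
Qed.

End GeometricSums.

(** * Powers and irreducible binomials over a finite field *)

Section FiniteFieldIrreducibility.
Variables (F : finFieldType) (xi : F).
Hypothesis prim_xi : (#|F|.-1).-primitive_root xi.
Implicit Types (a b c : F) (r s n : nat).

Lemma pred_card_finField_gt0 : (0 < #|F|.-1)%N.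
Proof. by have := finNzRing_gt1 F; case: #|F| => [|[]]. Qed.

Lemma expf_pred_card a : a != 0 -> a ^+ #|F|.-1 = 1.
Proof.
move=> a0; apply: (mulfI a0); rewrite -exprS prednK ?expf_card ?mulr1 //.
exact: ltnW (finNzRing_gt1 F).
Qed.

Lemma finField_log a : a != 0 -> exists s, a = xi ^+ s.
Proof. by move/expf_pred_card/(prim_rootP prim_xi) => [i ->]; exists i. Qed.

Lemma prim_root_neq0 : xi != 0.
Proof.
apply/eqP => xi0; have := prim_expr_order prim_xi.
by rewrite xi0 expr0n eqn0Ngt pred_card_finField_gt0 => /esym/eqP; rewrite oner_eq0.
Qed.

(** Exponents of [xi] are determined modulo q - 1, hence modulo its divisor r. *)
Lemma prim_exp_power r s b :
  (r %| #|F|.-1)%N -> b ^+ r = xi ^+ s -> (r %| s)%N.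
Proof.
move=> r_q bE; have b0 : b != 0.
  apply/eqP => b0; have := expf_neq0 s prim_root_neq0.
  rewrite -bE b0 expr0n; case: r r_q {bE} => [|r]; last by rewrite eqxx.
  by rewrite dvd0n eqn0Ngt pred_card_finField_gt0.
have [t tE] := finField_log b0; move/eqP: bE.
rewrite tE -exprM (eq_prim_root_expr prim_xi) => /eqP ts.
by rewrite /dvdn -(modn_dvdm s r_q) -ts modn_dvdm // -/(dvdn _ _) dvdn_mull.
Qed.

Lemma expf_div_eq1_power a r :
  (r %| #|F|.-1)%N -> a != 0 -> a ^+ (#|F|.-1 %/ r) = 1 -> exists b, b ^+ r = a.
Proof.
move=> r_q a0; have [s ->] := finField_log a0; rewrite -exprM => /eqP.
have r_gt0 := dvdn_gt0 pred_card_finField_gt0 r_q.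
rewrite -(prim_order_dvd prim_xi) -[X in (X %| _)%N](divnK r_q) mulnC.
have k_gt0 : (0 < #|F|.-1 %/ r)%N.
  by rewrite divn_gt0 //; apply: dvdn_leq r_q; apply: pred_card_finField_gt0.
rewrite dvdn_pmul2r // => /dvdnP[t ->].
by exists (xi ^+ t); rewrite -exprM.
Qed.

Lemma irreducible_factor (g : {poly F}) : (1 < size g)%N ->
  exists2 f, irreducible_poly f & f %| g.
Proof.
have [k] := ubnP (size g); elim: k g => // k IHk g gk g1.
have [g_irr|] := irreducibleP g; first by exists g.
move/irreducibleP; rewrite /irreducibleb g1 negb_forall => /existsP[h].
rewrite negb_imply -ltnNge => /andP[h_g h1].
have hg : (size h < size g)%N.
  by apply: leq_ltn_trans (size_npoly h) _; rewrite prednK // ltnW.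
have [f f_irr f_h] := IHk h (leq_trans hg gk) h1.
by exists f => //; apply: dvdp_trans f_h _; rewrite dvdpE.
Qed.

(* A root theta of X^n - a in a degree d extension satisfies theta^(q^d-1) = 1
   and theta^((q-1)n) = 1, hence theta^((q-1)g) = 1 for
   g = gcd(n, 1 + q + ... + q^(d-1)).  If g != n this makes a an r-th power
   for some prime r dividing n / g. *)
Lemma root_XnsubC_dvd_degree n a d (L : fieldExtType F) (theta : L) :
  (0 < n)%N -> ~~ (4 %| n)%N -> a != 0 ->
  (forall r, prime r -> (r %| n)%N ->
     (r %| #|F|.-1)%N /\ forall b, b ^+ r != a) ->
  \dim {: L} = d -> theta ^+ n = a%:A -> (n %| d)%N.
Proof.
move=> n_gt0 n4 a0 a_np dimL thetaE; set Q := #|F|.-1.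
have q_gt0 : (0 < #|F|)%N := ltnW (finNzRing_gt1 F).
have theta0 : theta != 0.
  apply/eqP => th0; move: thetaE; rewrite th0 expr0n eqn0Ngt n_gt0 => /esym/eqP.
  by rewrite scaler_eq0 oner_eq0 orbF (negPf a0).
have aA k : (a%:A : L) ^+ k = (a ^+ k)%:A by rewrite -(rmorphXn (in_alg L)).
apply: (@dvd_sum_expn #|F|) => //.
  move=> r r_pr r_n; have [r_q _] := a_np r r_pr r_n.
  by apply/eqP; rewrite eqn_mod_dvd // subn1.
set S := (\sum_(i < d) _)%N.
have S_gt0 : (0 < S)%N.
  have : (0 < d)%N by rewrite -dimL adim_gt0.
  by rewrite /S; case: d {dimL S} => // d _; rewrite big_ord_recl.
have thS : theta ^+ (Q * S) = 1.
  have := memvf theta; rewrite (Fermat's_little_theorem (aspacef L)) /= dimL.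
  have -> : (#|F| ^ d = (Q * S).+1)%N by rewrite -predn_exp prednK ?expn_gt0 ?q_gt0.
  by rewrite exprS => /eqP; rewrite -[RHS]mulr1 => /(mulfI theta0).
have thn : theta ^+ (Q * n) = 1.
  by rewrite mulnC exprM thetaE aA expf_pred_card // scale1r.
have thg : theta ^+ (Q * gcdn n S) = 1.
  have Qn_gt0 : (0 < Q * n)%N by rewrite muln_gt0 pred_card_finField_gt0.
  have [o o_prim o_dv] := prim_order_exists Qn_gt0 thn.
  apply/eqP; rewrite -(prim_order_dvd o_prim) muln_gcdr dvdn_gcd o_dv.
  by rewrite (prim_order_dvd o_prim) thS eqxx.
have [gn|gn] := eqVneq (gcdn n S) n; first by rewrite -gn dvdn_gcdr.
have g_n : (gcdn n S %| n)%N := dvdn_gcdl n S.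
have g_gt0 : (0 < gcdn n S)%N by rewrite gcdn_gt0 n_gt0.
have k_gt1 : (1 < n %/ gcdn n S)%N.
  by rewrite ltn_divRL // mul1n ltn_neqAle gn dvdn_leq.
set r := pdiv (n %/ gcdn n S).
have r_pr : prime r := pdiv_prime k_gt1.
have gr_n : (gcdn n S * r %| n)%N by rewrite mulnC -dvdn_divRL ?pdiv_dvd.
have r_n : (r %| n)%N := dvdn_trans (dvdn_mull _ (dvdnn r)) gr_n.
have [r_q /(_ _)/negP a_nr] := a_np r r_pr r_n.
have [|b] := @expf_div_eq1_power a r r_q a0; last by move/eqP/a_nr.
(* The power of [a] becomes theta^(n (q-1)/r). Since gcd(n, S) r divides n, this exponent is a
   multiple of (q-1) gcd(n, S). *)
apply: (fmorph_inj (in_alg L)); rewrite rmorph1 /= -aA -thetaE -exprM.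
have [t tE] := dvdnP gr_n; rewrite tE mulnA -mulnA -/Q.
rewrite [(r * _)%N]mulnC divnK // [(t * _)%N]mulnC mulnAC [(_ * Q)%N]mulnC.
by rewrite exprM thg expr1n.
Qed.

(** Adjoin a root of an irreducible factor f of a nonconstant divisor g. The extension has degree
    deg f, which n divides, so g already has degree n. *)
Lemma irreducible_XnsubC n a :
  (0 < n)%N -> ~~ (4 %| n)%N -> a != 0 ->
  (forall r, prime r -> (r %| n)%N ->
     (r %| #|F|.-1)%N /\ forall b, b ^+ r != a) ->
  irreducible_poly ('X^n - a%:P).
Proof.
move=> n_gt0 n4 a0 a_np; have szP : size ('X^n - a%:P) = n.+1 := size_XnsubC a n_gt0.
have P0 : 'X^n - a%:P != 0 by rewrite -size_poly_gt0 szP.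
split=> [|g g1 gP]; first by rewrite szP.
have g0 : g != 0 by apply: contraTneq gP => ->; rewrite dvd0p.
have [|f f_irr f_g] := @irreducible_factor g.
  by rewrite ltn_neqAle eq_sym g1 size_poly_gt0.
have [L dimL [theta f_th _]] := irredp_FAdjoin f_irr.
have thE : theta ^+ n = a%:A.
  have : root (map_poly (in_alg L) ('X^n - a%:P)) theta.
    rewrite root_factor_theorem; apply: dvdp_trans (_ : map_poly (in_alg L) f %| _).
      by rewrite -root_factor_theorem.
    by rewrite dvdp_map (dvdp_trans f_g gP).
  by rewrite rmorphB /= map_polyXn map_polyC rootE !hornerE subr_eq0 => /eqP.
have n_d := root_XnsubC_dvd_degree n_gt0 n4 a0 a_np dimL thE.
rewrite -dvdp_size_eqp // eqn_leq dvdp_leq //= szP.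
apply: leq_trans (dvdp_leq g0 f_g).
have [f1 _] := f_irr; case: (size f) f1 n_d => [|[|k]] // _ n_d.
by rewrite ltnS dvdn_leq.
Qed.

End FiniteFieldIrreducibility.

(** * Constacyclic codes as principal ideals *)

Section ConstacyclicIdeals.
Variables (F : fieldType) (N : nat) (lam : F) (C : {vspace 'rV[F]_N}).
Hypothesis N_gt0 : (0 < N)%N.
Implicit Types (f g h : {poly F}) (c : 'rV[F]_N).

Lemma cw_polyE c : cw_poly c = rVpoly c.
Proof.
by rewrite /rVpoly poly_def; apply: eq_bigr => i _; rewrite valK.
Qed.

(** The quotient in this division is the constant c_(N-1): the last coordinate wraps around and
    picks up the factor [lam]. *)
Lemma rVpoly_constashift c :
  rVpoly (constashift lam c) = ('X * rVpoly c) %% ('X^N - lam%:P).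
Proof.
have -> : 'X * rVpoly c =
    (cw c N.-1)%:P * ('X^N - lam%:P) + rVpoly (constashift lam c).
  apply/polyP => k; rewrite coefXM coefD coefCM coefB coefXn coefC !coef_rVpoly -/(cw c _).
  case: k => [|k] /=.
    rewrite eqn_leq [(N <= 0)%N]leqNgt N_gt0 /= sub0r mulrN.
    case: insubP => [i _ i0|]; last by rewrite N_gt0.
    by rewrite mxE i0 eqxx; ring.
  rewrite subr0; case: insubP => [i iN ik|].
    by rewrite mxE ik /= (ltn_eqF iN) mulr0 add0r.
  rewrite -leqNgt leq_eqVlt addr0 => /predU1P[NE|Nk].
    have -> : (k.+1 == N) = true by apply/eqP.
    by rewrite mulr1; congr (cw c _); rewrite NE.
  rewrite [_ == N]gtn_eqF // mulr0 /cw; case: insubP => // i iN _.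
  by rewrite ltnNge -ltnS Nk in iN.
rewrite modp_addl_mul_small //.
by rewrite size_XnsubC // ltnS /rVpoly size_poly.
Qed.

(** The preimage of the code in F[X], where gcds and Bezout relations are available. It is an ideal
    once the code is constacyclic. *)
Definition in_code_ideal f := poly_rV (f %% ('X^N - lam%:P)) \in C.

Lemma in_code_idealP c : (c \in C) = in_code_ideal (cw_poly c).
Proof.
rewrite /in_code_ideal cw_polyE modp_small ?rVpolyK //.
by rewrite size_XnsubC // ltnS /rVpoly size_poly.
Qed.

Lemma in_code_idealD f g :
  in_code_ideal f -> in_code_ideal g -> in_code_ideal (f + g).
Proof. by move=> If Ig; rewrite /in_code_ideal modpD linearD memvD. Qed.

Lemma in_code_idealZ a f : in_code_ideal f -> in_code_ideal (a *: f).
Proof. by move=> If; rewrite /in_code_ideal modpZl linearZ memvZ. Qed.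

Hypothesis C_cyc : is_constacyclic lam C.

Lemma in_code_idealMX f : in_code_ideal f -> in_code_ideal ('X * f).
Proof.
rewrite /in_code_ideal => /C_cyc; set c := poly_rV _.
rewrite -[constashift lam c]rVpolyK rVpoly_constashift /c poly_rV_K ?modp_mul //.
by rewrite -ltnS -(size_XnsubC lam N_gt0) ltn_modp -size_poly_gt0 size_XnsubC.
Qed.

Lemma in_code_idealMl h f : in_code_ideal f -> in_code_ideal (h * f).
Proof.
move=> If; elim/poly_ind: h => [|h a IHh].
  by rewrite mul0r /in_code_ideal mod0p linear0 mem0v.
rewrite mulrDl [h * 'X]mulrC -mulrA mul_polyC.
by apply: in_code_idealD; [apply: in_code_idealMX|apply: in_code_idealZ].
Qed.

Lemma in_code_ideal_gcdp f g :
  in_code_ideal f -> in_code_ideal g -> in_code_ideal (gcdp f g).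
Proof.
move=> If Ig; have [[a b] /=] := Bezoutp f g.
rewrite eqp_sym => /eqpf_eq[k _ ->].
by apply/in_code_idealZ/in_code_idealD; apply: in_code_idealMl.
Qed.

(** The generator is the gcd of X^N - lam and the polynomials of a basis of [C]. Bezout keeps it in
    the ideal, and by linearity it divides every codeword. *)
Lemma constacyclic_generator :
  exists2 g, g %| 'X^N - lam%:P & code_generated lam C g.
Proof.
pose g := foldr (fun c => gcdp (cw_poly c)) ('X^N - lam%:P) (vbasis C).
have Ig : in_code_ideal g.
  rewrite /g; have : {subset tval (vbasis C) <= C} by move=> c; exact: vbasis_mem.
  elim: (tval (vbasis C)) => [|c s IHs] sC /=.
    by rewrite /in_code_ideal modpp linear0 mem0v.
  apply: in_code_ideal_gcdp; first by rewrite -in_code_idealP sC ?mem_head.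
  by apply: IHs => x xs; rewrite sC // inE xs orbT.
have gP : g %| 'X^N - lam%:P.
  rewrite /g; elim: (tval (vbasis C)) => [|c s IHs] //=.
  exact: dvdp_trans (dvdp_gcdr _ _) IHs.
have gb c : c \in vbasis C -> g %| cw_poly c.
  rewrite /g memtE; elim: (tval (vbasis C)) => [|d s IHs] //=.
  rewrite inE => /predU1P[->|/IHs]; first exact: dvdp_gcdl.
  exact: dvdp_trans (dvdp_gcdr _ _).
have gC c : c \in C -> g %| cw_poly c.
  move/coord_vbasis->; rewrite cw_polyE linear_sum /=.
  apply: (big_ind (fun f => g %| f)) => [|x y|i _]; first exact: dvdp0.
    exact: dvdp_add.
  rewrite linearZ /= -mul_polyC -cw_polyE dvdp_mull // gb //.
  by rewrite mem_nth // size_tuple.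
exists g => // c; split=> [cC|[h cE]].
  have /dvdpP[h hE] := gC _ cC; exists h.
  rewrite [g * h]mulrC -hE modp_small //.
  by rewrite cw_polyE size_XnsubC // ltnS /rVpoly size_poly.
have := in_code_idealMl h Ig; rewrite /in_code_ideal [h * g]mulrC -cE.
by rewrite cw_polyE rVpolyK.
Qed.

End ConstacyclicIdeals.

Lemma code_generated_eqp (F : fieldType) N lam (C : {vspace 'rV[F]_N}) f g :
  f %= g -> code_generated lam C f -> code_generated lam C g.
Proof.
move=> /eqpf_eq[k k0 fE] fC c; rewrite fC; split=> [][h ->].
  by exists (k *: h); rewrite fE -scalerAl scalerAr.
by exists (k^-1 *: h); rewrite fE -scalerAl scalerAr scalerA mulfV // scale1r.
Qed.

(** * Parametrising the divisors of a product up to associates *)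

Section DivisorsOfProducts.
Variable F : fieldType.
Implicit Types A B f g : {poly F}.

Lemma eqp_mul A1 A2 B1 B2 : A1 %= A2 -> B1 %= B2 -> A1 * B1 %= A2 * B2.
Proof. by move=> /(eqp_mulr B1)/eqp_trans A12 /(eqp_mull A2)/A12. Qed.

(** Take g1 = gcd(g, A). Then g / g1 is coprime to A / g1 and divides (A / g1) B, so it divides B; A
    and B may share factors. *)
Lemma dvdp_mul_split g A B : A * B != 0 -> g %| A * B ->
  exists g1 g2, [/\ g1 %| A, g2 %| B & g = g1 * g2].
Proof.
rewrite mulf_eq0 negb_or => /andP[A0 B0] gAB.
have d0 : gcdp g A != 0 by rewrite gcdp_eq0 negb_and A0 orbT.
exists (gcdp g A), (g %/ gcdp g A); split; first exact: dvdp_gcdr.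
  have /Gauss_dvdpr <- : coprimep (g %/ gcdp g A) (A %/ gcdp g A).
    by apply: coprimep_div_gcd; rewrite A0 orbT.
  rewrite -(dvdp_mul2r _ _ d0) divpK ?dvdp_gcdl // mulrAC divpK ?dvdp_gcdr //.
by rewrite mulrC divpK ?dvdp_gcdl.
Qed.

(* [divisors_param ok G A]: up to associates, every divisor of [A] is a member
   [G t] of the family [G] for an admissible parameter [t]. *)
Definition divisors_param T (ok : T -> Prop) (G : T -> {poly F}) A :=
  A != 0 /\ forall g, g %| A -> exists2 t, ok t & g %= G t.

Lemma divisors_param_irreducible f k :
  irreducible_poly f -> divisors_param (fun e => e <= k)%N (fun e => f ^+ e) (f ^+ k).
Proof.
move=> f_irr; have f0 := irredp_neq0 f_irr.
split=> [|]; first exact: expf_neq0.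
elim: k => [|k IHk] g.
  by rewrite expr0 dvdp1 => g1; exists 0%N; rewrite // -size_poly_eq1.
rewrite exprS => /dvdp_mul_split[|g1 [g2 [g1f g2f ->]]].
  by rewrite mulf_neq0 ?expf_neq0.
have [e ek g2E] := IHk _ g2f.
have [g11|g1E] := irredp_XsubCP f_irr g1f.
  by exists e; [apply: leqW|rewrite -[f ^+ e]mul1r eqp_mul].
by exists e.+1; rewrite ?ltnS // exprS eqp_mul.
Qed.

Lemma divisors_param_mul T1 T2 (ok1 : T1 -> Prop) (ok2 : T2 -> Prop) G1 G2 A B :
  divisors_param ok1 G1 A -> divisors_param ok2 G2 B ->
  divisors_param (fun t => ok1 t.1 /\ ok2 t.2) (fun t => G1 t.1 * G2 t.2) (A * B).
Proof.
move=> [A0 DA] [B0 DB]; have AB0 : A * B != 0 by rewrite mulf_neq0.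
split=> // g /(dvdp_mul_split AB0)[g1 [g2 [/DA[t1 ok_t1 g1E] /DB[t2 ok_t2 g2E] ->]]].
by exists (t1, t2); rewrite // eqp_mul.
Qed.

Lemma divisors_param_prod (I : eqType) (s : seq I) (P : pred I) T (ok : T -> Prop)
    (t0 : T) (G : I -> T -> {poly F}) (A : I -> {poly F}) :
  uniq s -> ok t0 ->
  (forall i, i \in s -> P i -> divisors_param ok (G i) (A i)) ->
  divisors_param (fun t : I -> T => forall i, ok (t i))
    (fun t => \prod_(i <- s | P i) G i (t i)) (\prod_(i <- s | P i) A i).
Proof.
move=> s_uniq ok0; elim: s s_uniq => [|j s IHs] /=.
  move=> _ _; split=> [|g]; rewrite big_nil ?oner_neq0 // dvdp1 => g1.
  by exists (fun=> t0) => //; rewrite big_nil -size_poly_eq1.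
move=> /andP[js s_uniq] DA.
have [S0 DS] : divisors_param (fun t : I -> T => forall i, ok (t i))
    (fun t => \prod_(i <- s | P i) G i (t i)) (\prod_(i <- s | P i) A i).
  by apply: IHs => // i i_s; apply: DA; rewrite inE i_s orbT.
rewrite /divisors_param big_cons; case: ifP => Pj; last first.
  by split=> // g /DS[t ok_t gE]; exists t => //; rewrite big_cons Pj.
have [Aj0 DAj] := DA j (mem_head _ _) Pj.
have A0 : A j * \prod_(i <- s | P i) A i != 0 by rewrite mulf_neq0.
split=> // g /(dvdp_mul_split A0)[g1 [g2 [/DAj[t1 ok_t1 g1E] /DS[t ok_t g2E] ->]]].
(* As [s] has no repetition, changing the parameter at [j] leaves the factors of the tail
   untouched. *)
exists (fun i => if i == j then t1 else t i) => [i|]; first by case: ifP.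
rewrite big_cons Pj eqxx eqp_mul //; congr (_ %= _): g2E.
rewrite big_seq_cond [RHS]big_seq_cond; apply: eq_bigr => i /andP[i_s _].
by case: eqP js => // <-; rewrite i_s.
Qed.

Lemma divisors_param_prod2 (I J : eqType) (s : seq I) (r : seq J) (P : pred J) T
    (ok : T -> Prop) (t0 : T) (G : I -> J -> T -> {poly F}) (A : I -> J -> {poly F}) :
  uniq s -> uniq r -> ok t0 ->
  (forall i j, i \in s -> P j -> divisors_param ok (G i j) (A i j)) ->
  divisors_param (fun t : I -> J -> T => forall i j, ok (t i j))
    (fun t => \prod_(i <- s) \prod_(j <- r | P j) G i j (t i j))
    (\prod_(i <- s) \prod_(j <- r | P j) A i j).
Proof.
move=> s_uniq r_uniq ok0 DA.
apply: (@divisors_param_prod _ s xpredT _ (fun t => forall j, ok (t j)) (fun=> t0)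
  (fun i t => \prod_(j <- r | P j) G i j (t j))) => // i i_s _.
by apply: (divisors_param_prod r_uniq ok0) => j _; apply: DA.
Qed.

Lemma divisors_param_pair f f' k : irreducible_poly f -> irreducible_poly f' ->
  divisors_param (fun e : nat * nat => e.1 <= k /\ e.2 <= k)%N
    (fun e => f ^+ e.1 * f' ^+ e.2) (f ^+ k * f' ^+ k).
Proof.
move=> /(divisors_param_irreducible k) Df /(divisors_param_irreducible k).
exact: divisors_param_mul Df.
Qed.

End DivisorsOfProducts.

(** * Splitting binomials by roots of unity *)

Section Factorisations.
Variable F : fieldType.
Implicit Types (A W : {poly F}) (b c z : F).

Lemma prod_expr_pair (R : comNzRingType) (I : Type) (s : seq I) (P : pred I)
    (f f' : I -> R) k :
  \prod_(i <- s | P i) (f i ^+ k * f' i ^+ k) =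
  (\prod_(i <- s | P i) f i) ^+ k * (\prod_(i <- s | P i) f' i) ^+ k.
Proof. by rewrite big_split !prodrXl. Qed.

(** Substitute A / b for X in the factorisation of X^n - 1 and multiply by b^n. An arbitrary [A]
    allows powers of X in place of X. *)
Lemma prod_subC_prim_root n z b A : n.-primitive_root z -> b != 0 ->
  \prod_(0 <= i < n) (A - (b * z ^+ i)%:P) = A ^+ n - (b ^+ n)%:P.
Proof.
move=> z_prim b0.
have E i : A - (b * z ^+ i)%:P = b *: (('X - (z ^+ i)%:P) \Po (b^-1 *: A)).
  rewrite comp_polyB comp_polyX comp_polyC scalerBr scalerA mulfV // scale1r.
  by rewrite polyCM mul_polyC.
rewrite (eq_bigr _ (fun i _ => E i)) scaler_prod prodr_const_nat subn0.
rewrite -(rmorph_prod (comp_poly _)) /= factor_Xn_sub_1 //.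
rewrite rmorphB rmorph1 rmorphXn /= comp_polyX scalerBr exprZn scalerA exprVn.
by rewrite mulfV ?expf_neq0 // scale1r -mul_polyC mulr1.
Qed.

(** Since z^n = 1 = z^0, the indices may run from 1 to n, as they do for k in the generators. *)
Lemma prod_subC_prim_root1 n z b A : n.-primitive_root z -> b != 0 ->
  \prod_(1 <= i < n.+1) (A - (b * z ^+ i)%:P) = A ^+ n - (b ^+ n)%:P.
Proof.
move=> z_prim b0; rewrite -(prod_subC_prim_root A z_prim b0).
have n_gt0 := prim_order_gt0 z_prim.
rewrite big_nat_recr //= (prim_expr_order z_prim) mulrC.
by rewrite [RHS]big_ltn // expr0.
Qed.

(** The exponents divisible by l run through the powers of z^l, a primitive root of order l^v, and
    yield the smaller binomial; the others remain as the new factors. *)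
Lemma prod_subC_prim_root_coprime l v z b A :
  prime l -> (l ^ v.+1).-primitive_root z -> b != 0 ->
  (A ^+ (l ^ v) - (b ^+ (l ^ v))%:P) *
    \prod_(1 <= k < (l ^ v.+1).+1 | ~~ (l %| k)%N) (A - (b * z ^+ k)%:P) =
  A ^+ (l ^ v.+1) - (b ^+ (l ^ v.+1))%:P.
Proof.
move=> l_pr z_prim b0; have l_gt0 := prime_gt0 l_pr.
rewrite -[RHS](prod_subC_prim_root1 A z_prim b0) [RHS](bigID (fun k => l %| k)%N) /=.
congr (_ * _).
have zl_prim : (l ^ v).-primitive_root (z ^+ l).
  have := dvdn_prim_root z_prim (dvdn_exp2l l (leqnSn v)).
  by rewrite expnS mulnK ?expn_gt0 ?l_gt0.
rewrite -(prod_subC_prim_root1 A zl_prim b0).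
have -> : \prod_(1 <= i < (l ^ v).+1) (A - (b * z ^+ l ^+ i)%:P)
   = \prod_(k <- [seq (l * i)%N | i <- index_iota 1 (l ^ v).+1]) (A - (b * z ^+ k)%:P).
  by rewrite big_map; apply: eq_bigr => i _; rewrite -exprM.
rewrite -[RHS]big_filter; apply: perm_big; apply: uniq_perm.
- by rewrite map_inj_uniq ?iota_uniq // => i j /eqP; rewrite eqn_pmul2l // => /eqP.
- by rewrite filter_uniq // iota_uniq.
move=> k; rewrite mem_filter mem_index_iota; apply/mapP/andP => [[i]|[/dvdnP[i ->]]].
  rewrite mem_index_iota !ltnS => /andP[i_gt0 iv] ->.
  by rewrite dvdn_mulr // muln_gt0 l_gt0 i_gt0 expnS leq_pmul2l.
rewrite ltnS expnS [(i * l)%N]mulnC leq_pmul2l // muln_gt0 l_gt0 => iv.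
by exists i; rewrite // mem_index_iota ltnS.
Qed.

(** Induction on J: passing from J to J + 1 applies the preceding lemma with A = W^(l^(J+1)), which
    contributes exactly the factors with j = J + 1. *)
Lemma factor_subC_prime_power l v J z c W :
  prime l -> (0 < v)%N -> (l ^ v).-primitive_root z -> c != 0 ->
  W ^+ (l ^ (v + J)) - (c ^+ (l ^ (v + J)))%:P =
  (\prod_(0 <= i < l ^ v) (W - (c * z ^+ i)%:P)) *
  \prod_(1 <= j < J.+1) \prod_(1 <= k < (l ^ v).+1 | ~~ (l %| k)%N)
     (W ^+ (l ^ j) - (c ^+ (l ^ j) * z ^+ k)%:P).
Proof.
move=> l_pr; case: v => // v _ z_prim c0; rewrite prod_subC_prim_root //.
elim: J => [|J IHJ]; first by rewrite addn0 big_geq // mulr1.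
rewrite big_nat_recr //= mulrA -IHJ.
have := prod_subC_prim_root_coprime (W ^+ (l ^ J.+1)) l_pr z_prim (expf_neq0 (l ^ J.+1) c0).
rewrite -!exprM -!expnD (_ : J.+1 + v = v.+1 + J)%N; last by lia.
by rewrite [(J.+1 + _)%N]addnC.
Qed.

End Factorisations.

(** * Arithmetic of q - 1 and normalisation of [lam] *)

Section ConstacyclicCodesOfLength2lmpn.
Variables (F : finFieldType) (p l m n : nat) (xi lam : F).
Hypotheses (p_pr : prime p) (odd_p : odd p) (char_p : p \in [pchar F]).
Hypothesis prim_xi : (#|F|.-1).-primitive_root xi.
Hypotheses (l_pr : prime l) (odd_l : odd l).
Hypothesis l_dvd : (l %| #|F|.-1)%N.
Hypotheses (m_gt0 : (0 < m)%N) (lam0 : lam != 0).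

Let Q := #|F|.-1.
Let u := logn l Q.
Let v := minn m u.
Let N := (2 * l ^ m * p ^ n)%N.
Let zeta := xi ^+ (Q %/ l ^ v).

Lemma pred_card_even : (2 %| Q)%N.
Proof.
rewrite dvdn2; apply/negP => odd_Q.
have /eqP : (-1 : F) ^+ Q = 1 by rewrite expf_pred_card // oppr_eq0 oner_neq0.
rewrite -signr_odd odd_Q expr1 -subr_eq0 -opprD oppr_eq0 => char2.
have : 2%N \in [pchar F] by rewrite inE /= mulr2n.
by rewrite (pcharf_eq char_p) inE => /eqP p2; have := odd_p; rewrite -p2.
Qed.

(** If p divided q - 1, injectivity of Frobenius would give xi^((q-1)/p) = 1, against the order of
    [xi]. *)
Lemma pchar_coprime_pred_card : coprime p Q.
Proof.
rewrite prime_coprime //; apply/negP => p_Q.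
have Q_gt0 : (0 < Q)%N := pred_card_finField_gt0 F.
have : xi ^+ (Q %/ p) = 1.
  apply: (fmorph_inj (pFrobenius_aut char_p)).
  by rewrite rmorph1 /= pFrobenius_autE -exprM divnK // prim_expr_order.
move/eqP; rewrite -(prim_order_dvd prim_xi) => /dvdn_leq.
rewrite divn_gt0 ?prime_gt0 // dvdn_leq // => /(_ isT).
by rewrite leqNgt ltn_Pdiv // prime_gt1.
Qed.

Lemma logn_pred_card_gt0 : (0 < u)%N.
Proof. by rewrite logn_gt0 mem_primes l_pr pred_card_finField_gt0 l_dvd. Qed.

Lemma minn_logn_gt0 : (0 < v)%N.
Proof. by rewrite leq_min m_gt0 logn_pred_card_gt0. Qed.

Lemma expn_dvd_pred_card k : (k <= u)%N -> (l ^ k %| Q)%N.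
Proof. by move=> ku; apply: dvdn_trans (dvdn_exp2l l ku) (pfactor_dvdnn l Q). Qed.

Lemma coprime_2_expn k : coprime 2 (l ^ k).
Proof. by rewrite coprime2n oddX odd_l orbT. Qed.

Lemma double_expn_dvd_pred_card : (2 * l ^ v %| Q)%N.
Proof.
by rewrite Gauss_dvd ?coprime_2_expn // pred_card_even expn_dvd_pred_card // geq_minr.
Qed.

Lemma even_pred_card_div k : (k <= u)%N -> ~~ odd (Q %/ l ^ k).
Proof.
move=> ku; have : (2 %| Q %/ l ^ k * l ^ k)%N.
  by rewrite divnK ?pred_card_even ?expn_dvd_pred_card.
by rewrite dvdn2 oddM oddX odd_l orbT andbT.
Qed.

Lemma dvd_pred_card_div k : (k < u)%N -> (l %| Q %/ l ^ k)%N.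
Proof.
by move=> ku; rewrite dvdn_divRL ?expn_dvd_pred_card 1?ltnW // -expnS expn_dvd_pred_card.
Qed.

Lemma ndvd_pred_card_div : ~~ (l %| Q %/ l ^ u)%N.
Proof.
rewrite dvdn_divRL ?expn_dvd_pred_card // -expnS.
by rewrite pfactor_dvdn ?ltnn // pred_card_finField_gt0.
Qed.

Lemma prim_root_div k : (k <= u)%N -> (l ^ k).-primitive_root (xi ^+ (Q %/ l ^ k)).
Proof. by move=> ku; apply: dvdn_prim_root (expn_dvd_pred_card ku). Qed.

(** This is why cosets of the group generated by xi^(2 l^v) occur: that group consists of the N-th
    powers. *)
Lemma gcdn_length_pred_card : gcdn N Q = (2 * l ^ v)%N.
Proof.
rewrite gcdnC /N Gauss_gcdl; last first.
  by rewrite coprime_sym coprimeXl ?pchar_coprime_pred_card.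
rewrite gcdnC; have [Q2 Q2E] := dvdnP pred_card_even.
rewrite Q2E [(Q2 * 2)%N]mulnC -muln_gcdr; congr (2 * _)%N.
rewrite -(Gauss_gcdr _ (_ : coprime (l ^ m) 2)) 1?coprime_sym ?coprime_2_expn //.
rewrite mulnC -Q2E -[Q](divnK (expn_dvd_pred_card (leqnn u))) Gauss_gcdr; last first.
  by rewrite coprimeXl // prime_coprime // ndvd_pred_card_div.
rewrite /v /minn; case: ltnP => mu.
  by apply/gcdn_idPl; rewrite dvdn_exp2l // ltnW.
by apply/gcdn_idPr; rewrite dvdn_exp2l.
Qed.

Lemma exists_length_root s : in_coset xi s (2 * l ^ v) lam ->
  exists c, c != 0 /\ c ^+ N * lam = xi ^+ s.
Proof.
move=> [t lamE]; have N_gt0 : (0 < N)%N by rewrite !muln_gt0 !expn_gt0 !prime_gt0.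
case: (egcdnP Q N_gt0) => a b abE _; rewrite gcdn_length_pred_card in abE.
have xi0 := prim_root_neq0 prim_xi.
(* By Bezout a N = b Q + 2 l^v, so the N-th power of xi^(a t) is xi^(2 l^v t). *)
exists ((xi ^+ (a * t)) ^-1); split; first by rewrite invr_eq0 expf_neq0.
rewrite exprVn -exprM mulnAC abE lamE mulnDl !exprD -mulnA [(b * _)%N]mulnC.
rewrite -mulnA exprM (prim_expr_order prim_xi) expr1n mul1r.
by rewrite mulrC mulfK // expf_neq0.
Qed.

(** As p^n is invertible modulo 2 l^v, the exponent of [lam] can be divided by p^n modulo 2 l^v. *)
Lemma exists_coset : exists2 j, (j < 2 * l ^ v)%N & in_coset xi (j * p ^ n) (2 * l ^ v) lam.
Proof.
set d := (2 * l ^ v)%N.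
have d_gt0 : (0 < d)%N by rewrite muln_gt0 expn_gt0 (prime_gt0 l_pr).
have [a lamE] := finField_log prim_xi lam0.
have pn_gt0 : (0 < p ^ n)%N by rewrite expn_gt0 prime_gt0.
have cop : coprime (p ^ n) d.
  rewrite coprimeXl //; apply: coprime_dvdr double_expn_dvd_pred_card _.
  exact: pchar_coprime_pred_card.
case: (egcdnP d pn_gt0) => x y xyE _; rewrite (eqP cop) in xyE.
pose j := ((a * x) %% d)%N; exists j; first exact: ltn_pmod.
have Q_gt0 : (0 < Q)%N := pred_card_finField_gt0 F.
(* Adding a multiple of Q does not change the power of [xi] and keeps the difference of exponents
   nonnegative. *)
have le_a : (j * p ^ n <= a + Q * (j * p ^ n))%N.
  by apply: leq_trans (leq_addl _ _); rewrite leq_pmull.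
have/dvdnP[t tE] : (d %| a + Q * (j * p ^ n) - j * p ^ n)%N.
  rewrite -eqn_mod_dvd // modnMml -mulnA xyE -modnDmr.
  have /dvdnP[w ->] := double_expn_dvd_pred_card; rewrite -/d.
  rewrite [(w * d)%N]mulnC -mulnA modnMr addn0 mulnDr muln1 mulnA modnMDl.
  by [].
exists t; rewrite [(d * t)%N]mulnC -tE subnKC // exprD exprM.
by rewrite (prim_expr_order prim_xi) expr1n mulr1.
Qed.

Lemma pow_pchar_sub (A : {poly F}) b :
  (A - b%:P) ^+ (p ^ n) = A ^+ (p ^ n) - (b ^+ (p ^ n))%:P.
Proof.
rewrite exprDn_pchar.
  by rewrite exprNn -signr_odd oddX odd_p orbT expr1 mulN1r polyC_exp.
by rewrite pnatX pnatE // pchar_poly char_p.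
Qed.

Lemma XN_sub_lam c s : c ^+ N * lam = xi ^+ (s * p ^ n) ->
  'X^N - lam%:P = ('X^(2 * l ^ m) - (c^-1 ^+ (2 * l ^ m) * xi ^+ s)%:P) ^+ (p ^ n).
Proof.
move=> cE; have cN0 : c ^+ N != 0.
  apply: contra_eq_neq cE => /= ->.
  by rewrite mul0r eq_sym expf_neq0 // (prim_root_neq0 prim_xi).
rewrite pow_pchar_sub -exprM -/N exprMn -!exprM -/N -cE exprVn mulKf //.
Qed.

Lemma length_root_neq0 c s : c ^+ N * lam = xi ^+ s -> c != 0.
Proof.
move=> cE; apply: contra_eq_neq cE => ->.
rewrite expr0n eqn0Ngt !muln_gt0 !expn_gt0 !prime_gt0 //= mul0r eq_sym.
by rewrite expf_neq0 // (prim_root_neq0 prim_xi).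
Qed.

(** The only prime that can divide l^j is l, and none does when j = 0; hence the guarded
    hypothesis. *)
Lemma irreducible_Xln_subC j (a : F) : a != 0 -> ((0 < j)%N -> forall b, b ^+ l != a) ->
  irreducible_poly ('X^(l ^ j) - a%:P).
Proof.
move=> a0 a_nl; apply: (irreducible_XnsubC prim_xi) => //.
- by rewrite expn_gt0 prime_gt0.
- apply/negP => /(dvdn_trans (_ : 2 %| 4)%N) => /(_ isT).
  by rewrite dvdn2 oddX odd_l orbT.
move=> r r_pr; rewrite Euclid_dvdX // => /andP[].
by rewrite dvdn_prime2 // => /eqP -> /a_nl.
Qed.

Lemma irreducible_X2ln_subC j (a : F) : a != 0 -> (forall b, b ^+ 2 != a) ->
  ((0 < j)%N -> forall b, b ^+ l != a) -> irreducible_poly ('X^(2 * l ^ j) - a%:P).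
Proof.
move=> a0 a_n2 a_nl; apply: (irreducible_XnsubC prim_xi) => //.
- by rewrite muln_gt0 expn_gt0 (prime_gt0 l_pr).
- by rewrite -[4%N]/(2 * 2)%N dvdn_pmul2l // dvdn2 oddX odd_l orbT.
move=> r r_pr; rewrite Euclid_dvdM // => /orP[].
  by rewrite dvdn_prime2 // => /eqP ->; rewrite pred_card_even.
rewrite Euclid_dvdX // => /andP[].
by rewrite dvdn_prime2 // => /eqP -> /a_nl.
Qed.

(** * Generators of the code in each case *)

Section Codes.
Variable C : {vspace 'rV[F]_N}.
Hypothesis C_cyc : is_constacyclic lam C.

Lemma code_generated_param T (ok : T -> Prop) (G : T -> {poly F}) A :
  'X^N - lam%:P = A -> divisors_param ok G A ->
  exists2 t, ok t & code_generated lam C (G t).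
Proof.
have N_gt0 : (0 < N)%N by rewrite !muln_gt0 !expn_gt0 (prime_gt0 l_pr) (prime_gt0 p_pr).
move=> AE [_ DA]; have [g g_dv gC] := constacyclic_generator N_gt0 C_cyc.
rewrite AE in g_dv; have [t ok_t gt] := DA _ g_dv.
by exists t => //; apply: code_generated_eqp gt gC.
Qed.

(** Truncated subtraction lets one factorisation serve both m <= u, with no factors beyond the first
    product, and u < m. *)
Lemma minn_logn_addn : m = (v + (m - u))%N.
Proof. by rewrite /v; lia. Qed.

Lemma minn_logn_eqr : (u <= m)%N -> v = u.
Proof. by rewrite /v; lia. Qed.

Lemma prim_root_zeta : (l ^ v).-primitive_root zeta.
Proof. exact/prim_root_div/geq_minr. Qed.

Lemma prim_exp_nonpower r s (c b : F) :
  (r %| Q)%N -> ~~ (r %| s)%N -> c != 0 -> b ^+ r != c ^+ r * xi ^+ s.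
Proof.
move=> r_Q rs c0; apply: contra rs => /eqP bE.
apply: (prim_exp_power prim_xi r_Q (b := b / c)).
by rewrite expr_div_n bE mulrC mulKf ?expf_neq0.
Qed.

(** Here v = u, so [zeta ^+ k] is [xi] to the exponent k (q-1)/l^u, neither factor of which is
    divisible by l. *)
Lemma zeta_exp_nonpower k (c b : F) : (u <= m)%N -> ~~ (l %| k)%N -> c != 0 ->
  b ^+ l != c ^+ l * zeta ^+ k.
Proof.
move=> um lk; rewrite -exprM; apply: prim_exp_nonpower => //.
by rewrite Euclid_dvdM // minn_logn_eqr // negb_or ndvd_pred_card_div.
Qed.

(** With d = 1/c, X^(2 l^m) - d^(2 l^m) is a difference of squares. As l is odd, its two halves are
    the same binomial for d and for -d, so one factorisation gives both families. *)
Lemma code_caseI (c : F) : c ^+ N * lam = 1 ->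
  exists (eps eps' : nat -> nat) (tau sig : nat -> nat -> nat),
    [/\ forall i, (eps i <= p ^ n)%N, forall i, (eps' i <= p ^ n)%N,
        forall j k, (tau j k <= p ^ n)%N, forall j k, (sig j k <= p ^ n)%N
      & code_generated lam C (genI l v m u c zeta eps eps' tau sig)].
Proof.
move=> cE; have cE0 : c ^+ N * lam = xi ^+ (0 * p ^ n) by rewrite mul0n expr0.
have c0 : c^-1 != 0 by rewrite invr_eq0 (length_root_neq0 cE0).
set d := c^-1 in c0.
pose f i := 'X - (d * zeta ^+ i)%:P; pose f' i := 'X + (d * zeta ^+ i)%:P.
pose h j k := 'X^(l ^ j) - (d ^+ (l ^ j) * zeta ^+ k)%:P.
pose h' j k := 'X^(l ^ j) + (d ^+ (l ^ j) * zeta ^+ k)%:P.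
have dN j k : - (d ^+ (l ^ j) * zeta ^+ k) = (- d) ^+ (l ^ j) * zeta ^+ k.
  by rewrite exprNn -signr_odd oddX odd_l orbT expr1 mulN1r mulNr.
have E1 e : e != 0 -> 'X^(l ^ m) - (e ^+ (l ^ m))%:P =
    (\prod_(0 <= i < l ^ v) ('X - (e * zeta ^+ i)%:P)) *
    \prod_(1 <= j < (m - u).+1) \prod_(1 <= k < (l ^ v).+1 | ~~ (l %| k)%N)
       ('X^(l ^ j) - (e ^+ (l ^ j) * zeta ^+ k)%:P).
  by move=> e0; rewrite {1 2}minn_logn_addn
    (factor_subC_prime_power _ _ l_pr minn_logn_gt0 prim_root_zeta).
pose K := (p ^ n)%N.
have AE : 'X^N - lam%:P = (\prod_(0 <= i < l ^ v) (f i ^+ K * f' i ^+ K)) *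
    \prod_(1 <= j < (m - u).+1) \prod_(1 <= k < (l ^ v).+1 | ~~ (l %| k)%N)
      (h j k ^+ K * h' j k ^+ K).
  under [X in _ = _ * X]eq_bigr do rewrite prod_expr_pair.
  rewrite !prod_expr_pair mulrACA -!exprMn (XN_sub_lam cE0) expr0 mulr1 -/d.
  congr (_ ^+ _); rewrite [(2 * _)%N]mulnC !exprM polyC_exp subr_sqr.
  rewrite E1 //; congr (_ * _).
  have -> : (d ^+ (l ^ m))%:P = - ((- d) ^+ (l ^ m))%:P.
    by have := dN m 0%N; rewrite expr0 !mulr1 => <-; rewrite polyCN opprK.
  rewrite E1 ?oppr_eq0 //; congr (_ * _).
    by apply: eq_bigr => i _; rewrite mulNr polyCN opprK.
  by do 2![apply: eq_bigr => ? _]; rewrite -dN polyCN opprK.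
have D1 i : divisors_param (fun e : nat * nat => e.1 <= K /\ e.2 <= K)%N
    (fun e => f i ^+ e.1 * f' i ^+ e.2) (f i ^+ K * f' i ^+ K).
  by apply: divisors_param_pair; [apply: irredp_XsubC|apply: irredp_XaddC].
have D2 j k : j \in index_iota 1 (m - u).+1 -> ~~ (l %| k)%N ->
    divisors_param (fun e : nat * nat => e.1 <= K /\ e.2 <= K)%N
    (fun e => h j k ^+ e.1 * h' j k ^+ e.2) (h j k ^+ K * h' j k ^+ K).
  rewrite mem_index_iota => j1 lk; have um : (u <= m)%N by lia.
  (* Since j is positive, e^(l^j) is an l-th power and only [zeta ^+ k] matters. The statement is
     used for both d and -d. *)
  have nl (e b : F) : e != 0 -> b ^+ l != e ^+ (l ^ j) * zeta ^+ k.
    move=> e0; case: j j1 => // j _.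
    by rewrite expnSr exprM; apply: zeta_exp_nonpower; rewrite // expf_neq0.
  have zeta0 : zeta != 0 by rewrite expf_neq0 // (prim_root_neq0 prim_xi).
  have nz (e : F) : e != 0 -> e ^+ (l ^ j) * zeta ^+ k != 0.
    by move=> e0; apply: mulf_neq0; apply: expf_neq0.
  apply: divisors_param_pair.
    by apply: irreducible_Xln_subC => [|_ b]; [apply: nz|apply: nl].
  rewrite /h' -[_%:P]opprK -polyCN dN.
  by apply: irreducible_Xln_subC => [|_ b]; [apply: nz|apply: nl]; rewrite oppr_eq0.
have ok0 : (0 <= K /\ 0 <= K)%N by [].
have D := divisors_param_mul
  (divisors_param_prod (P := xpredT) (t0 := (0, 0)%N) (iota_uniq 0 (l ^ v - 0)) ok0
     (fun i _ _ => D1 i))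
  (divisors_param_prod2 (t0 := (0, 0)%N) (iota_uniq 1 ((m - u).+1 - 1))
     (iota_uniq 1 ((l ^ v).+1 - 1)) ok0 D2).
have [[e t] /= [ok_e ok_t] Ct] := code_generated_param AE D.
exists (fun i => (e i).1), (fun i => (e i).2),
  (fun j k => (t j k).1), (fun j k => (t j k).2); split.
- by move=> i; have [] := ok_e i.
- by move=> i; have [] := ok_e i.
- by move=> j k; have [] := ok_t j k.
- by move=> j k; have [] := ok_t j k.
congr code_generated: Ct; rewrite /genI big_mkord; congr (_ * _).
by do 2![apply: eq_bigr => ? _]; rewrite -exprVn.
Qed.
Lemma code_generated_prod L (f : nat -> {poly F}) :
  (forall i, irreducible_poly (f i)) ->
  'X^N - lam%:P = (\prod_(0 <= i < L) f i) ^+ (p ^ n) ->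
  exists eps : nat -> nat, (forall i, (eps i <= p ^ n)%N) /\
    code_generated lam C (\prod_(0 <= i < L) f i ^+ eps i).
Proof.
move=> f_irr; rewrite -prodrXl => AE.
have D := divisors_param_prod (P := xpredT) (t0 := 0%N) (iota_uniq 0 (L - 0))
  (leq0n (p ^ n))
  (fun i _ _ => divisors_param_irreducible (p ^ n) (f_irr i)).
by have [t ok_t Ct] := code_generated_param AE D; exists t.
Qed.

Lemma code_caseIIA (c : F) : (m <= u)%N -> c ^+ N * lam = xi ^+ (l ^ v * p ^ n) ->
  exists eps : nat -> nat, (forall i, (eps i <= p ^ n)%N) /\
    code_generated lam C (genIIA l m c xi (xi ^+ (Q %/ l ^ m)) eps).
Proof.
move=> mu cE; have vm : v = m by rewrite /v; lia.
have c0 : c^-1 != 0 by rewrite invr_eq0 (length_root_neq0 cE).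
have xi0 := prim_root_neq0 prim_xi.
set a := xi ^+ _; pose f i := 'X^2 - (c ^- 2 * xi * a ^+ i)%:P.
have [i||eps [ok_eps Ce]] := @code_generated_prod (l ^ m) f; last first.
- by exists eps; split=> //; rewrite /genIIA -(big_mkord xpredT (fun i => f i ^+ eps i)).
- rewrite (prod_subC_prim_root _ (prim_root_div mu)); last first.
    by rewrite mulf_neq0 // invr_eq0 expf_neq0 // -invr_eq0.
  by rewrite (XN_sub_lam cE) vm -!exprM exprMn -exprVn -!exprM.
rewrite /f -[2%N]/(2 * l ^ 0)%N; apply: irreducible_X2ln_subC => // [|b].
  by rewrite !mulf_neq0 ?invr_eq0 ?expf_neq0 // -invr_eq0.
(* The constant is a square times [xi] to the exponent 1 + i (q-1)/l^m, which is odd because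
   (q-1)/l^m is even. *)
rewrite -exprVn -mulrA /a -exprM -exprS; apply: prim_exp_nonpower => //.
  exact: pred_card_even.
by rewrite dvdn2 /= negbK oddM (negPf (even_pred_card_div mu)).
Qed.

(** Now xi^(l^u) = beta^(-l^m), so the binomial is W^(l^m) - d^(l^m) with W = X^2 and d = c^(-2)
    beta^(-1). *)
Lemma code_caseIIB (c beta : F) t : (u < m)%N -> c ^+ N * lam = xi ^+ (l ^ v * p ^ n) ->
  beta = xi ^+ (l ^ u * t) -> beta ^+ (l ^ m) * xi ^+ (l ^ u) = 1 ->
  exists (eps : nat -> nat) (sig : nat -> nat -> nat),
    [/\ forall i, (eps i <= p ^ n)%N, forall j k, (sig j k <= p ^ n)%N
      & code_generated lam C (genIIB l m u c beta zeta eps sig)].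
Proof.
move=> um cE betaE beta_m; have vu : v = u := minn_logn_eqr (ltnW um).
have c0 : c^-1 != 0 by rewrite invr_eq0 (length_root_neq0 cE).
have xi0 := prim_root_neq0 prim_xi.
have beta0 : beta != 0 by rewrite betaE expf_neq0.
have zeta0 : zeta != 0 by rewrite expf_neq0.
(* 1 is a square, so the exponent l^u t l^m + l^u of [xi] is even; as l is odd, t is odd. *)
have odd_t : odd t.
  have := prim_exp_power prim_xi (s := l ^ u * t * l ^ m + l ^ u) (b := 1) pred_card_even.
  rewrite exprD exprM -betaE beta_m expr1n => /(_ erefl).
  by rewrite dvdn2 oddD !oddM !oddX odd_l !orbT andbT /=; case: odd.
pose d := c ^- 2 * beta^-1.
have d0 : d != 0 by rewrite mulf_neq0 ?invr_eq0 ?expf_neq0 // -invr_eq0.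
pose f i := 'X^2 - (d * zeta ^+ i)%:P.
pose h j k := 'X^2 ^+ (l ^ j) - (d ^+ (l ^ j) * zeta ^+ k)%:P.
pose K := (p ^ n)%N.
have AE : 'X^N - lam%:P = (\prod_(0 <= i < l ^ v) f i ^+ K) *
    \prod_(1 <= j < (m - u).+1) \prod_(1 <= k < (l ^ v).+1 | ~~ (l %| k)%N) h j k ^+ K.
  under [X in _ = _ * X]eq_bigr do rewrite prodrXl.
  rewrite !prodrXl -exprMn
    -(factor_subC_prime_power _ _ l_pr minn_logn_gt0 prim_root_zeta) //.
  rewrite -minn_logn_addn (XN_sub_lam cE) -exprM vu exprMn -!exprVn -exprM.
  congr ((_ - (_ * _)%:P) ^+ _).
  rewrite exprVn; apply: (mulfI (expf_neq0 (l ^ m) beta0)).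
  by rewrite beta_m mulfV ?expf_neq0.
(* An odd power of beta^-1 times a power of zeta is an odd power of xi
   up to squares. *)
have n2 j k (b : F) : b ^+ 2 != d ^+ (l ^ j) * zeta ^+ k.
  have -> : d ^+ (l ^ j) * zeta ^+ k =
     ((c^-1 / beta) ^+ (l ^ j)) ^+ 2 * xi ^+ (l ^ u * t * l ^ j + Q %/ l ^ v * k).
    rewrite exprD [xi ^+ (_ * _ * _)]exprM -betaE [xi ^+ (_ * k)]exprM -/zeta mulrA.
    congr (_ * _); rewrite -!exprM mulnC exprM -exprMn; congr (_ ^+ _).
    rewrite /d -exprVn exprMn -mulrA; congr (_ * _).
    by rewrite expr2 -mulrA mulVf ?mulr1.
  apply: prim_exp_nonpower; rewrite ?pred_card_even ?expf_neq0 ?mulf_neq0 ?invr_eq0 //.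
    rewrite dvdn2 oddD !oddM !oddX odd_l odd_t !orbT (negPf (even_pred_card_div _)) //.
    exact: geq_minr.
  by rewrite -invr_eq0.
have D1 i : divisors_param (fun e => e <= K)%N (fun e => f i ^+ e) (f i ^+ K).
  apply: divisors_param_irreducible; rewrite /f -[2%N]/(2 * l ^ 0)%N.
  apply: irreducible_X2ln_subC => // [|b]; first by rewrite mulf_neq0 ?expf_neq0.
  by have := n2 0%N i b; rewrite expn0 expr1.
have D2 j k : j \in index_iota 1 (m - u).+1 -> ~~ (l %| k)%N ->
    divisors_param (fun e => e <= K)%N (fun e => h j k ^+ e) (h j k ^+ K).
  rewrite mem_index_iota => j1 lk; apply: divisors_param_irreducible.
  rewrite /h -exprM; apply: irreducible_X2ln_subC => [|b|_ b].
  - by rewrite mulf_neq0 ?expf_neq0.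
  - exact: n2.
  case: j j1 => // j _; rewrite expnSr exprM.
  by apply: zeta_exp_nonpower; rewrite ?expf_neq0 // ltnW.
have D := divisors_param_mul
  (divisors_param_prod (P := xpredT) (t0 := 0%N) (iota_uniq 0 (l ^ v - 0)) (leq0n K)
     (fun i _ _ => D1 i))
  (divisors_param_prod2 (t0 := 0%N) (iota_uniq 1 ((m - u).+1 - 1))
     (iota_uniq 1 ((l ^ v).+1 - 1)) (leq0n K) D2).
have [[e s] /= [ok_e ok_s] Ct] := code_generated_param AE D.
exists e, s; split=> //.
congr code_generated: Ct; rewrite /genIIB -vu big_mkord; congr (_ * _).
by do 2![apply: eq_bigr => ? _]; rewrite /h -exprM /d exprMn -!exprVn -exprM.
Qed.

(** * Case III: an index other than 0 and l^v *)

Section CaseIII.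
Variables (j : nat) (c : F).
Hypotheses (j_bounds : (1 <= j <= 2 * l ^ v - 1)%N) (j_neq : j != (l ^ v)%N).
Hypothesis cE : c ^+ N * lam = xi ^+ (j * p ^ n).
Let z := logn l j.
Let y := (j %/ l ^ z)%N.
Let delta := xi ^+ (Q %/ l ^ z).

(** The only multiple of l^v strictly between 0 and 2 l^v is l^v itself, which is excluded. *)
Lemma logn_index_lt_minn : (z < v)%N.
Proof.
rewrite ltnNge -pfactor_dvdn //; last by lia.
apply/negP => /dvdnP[k jE]; move: j_bounds j_neq; rewrite jE.
case: k {jE} => [|[|k]]; rewrite ?mul1n ?eqxx // => /andP[_ k_le] _.
have lv_gt0 : (0 < l ^ v)%N by rewrite expn_gt0 prime_gt0.
have := leq_trans (leq_mul (isT : 2 <= k.+2)%N (leqnn (l ^ v))) k_le.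
by rewrite leqNgt ltn_subrL muln_gt0 lv_gt0.
Qed.

Lemma index_factorE : j = (y * l ^ z)%N.
Proof. by rewrite divnK // pfactor_dvdnn. Qed.

Lemma index_cofactor_ndvd : ~~ (l %| y)%N.
Proof.
rewrite dvdn_divRL ?pfactor_dvdnn // -expnS pfactor_dvdn ?ltnn //.
by case/andP: j_bounds.
Qed.

Lemma logn_index_lt : (z < u)%N.
Proof. exact: leq_trans logn_index_lt_minn (geq_minr _ _). Qed.

Lemma length_root_inv_neq0 : c^-1 != 0.
Proof. by rewrite invr_eq0 (length_root_neq0 cE). Qed.

Lemma expn_split_logn_index : (l ^ m = l ^ (m - z) * l ^ z)%N.
Proof.
by rewrite -expnD subnK // (leq_trans (ltnW logn_index_lt_minn)) // geq_minl.
Qed.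

(** From z < m and z < u, both e^(l^(m-z)) and [delta] are l-th powers, so everything rests on
    [xi ^+ x]. *)
Lemma delta_exp_nonpower x i (b e : F) : ~~ (l %| x)%N -> e != 0 ->
  b ^+ l != e ^+ (l ^ (m - z)) * delta ^+ i * xi ^+ x.
Proof.
move=> lx e0; have mz : (0 < m - z)%N.
  by rewrite subn_gt0 (leq_trans logn_index_lt_minn) // geq_minl.
rewrite -mulrA /delta -exprM -exprD -(prednK mz) expnSr exprM.
apply: prim_exp_nonpower; rewrite ?expf_neq0 //.
by rewrite dvdn_addr // dvdn_mulr // dvd_pred_card_div // logn_index_lt.
Qed.

(** With j = y l^z the binomial is A^(l^z) - b^(l^z) for A = X^(2 l^(m-z)), and [delta] splits it.
    The factors stay irreducible: [delta] is a square and y is odd and prime to l. *)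
Lemma code_caseIIIA : odd y ->
  exists eps : nat -> nat, (forall i, (eps i <= p ^ n)%N) /\
    code_generated lam C (genIIIA l m z y c delta xi eps).
Proof.
move=> odd_y; have c0 := length_root_inv_neq0; have xi0 := prim_root_neq0 prim_xi.
pose f i := 'X^(2 * l ^ (m - z)) - (c ^- (2 * l ^ (m - z)) * delta ^+ i * xi ^+ y)%:P.
have [i||eps [ok_eps Ce]] := @code_generated_prod (l ^ z) f; last first.
- by exists eps; split=> //; rewrite /genIIIA -(big_mkord xpredT (fun i => f i ^+ eps i)).
- rewrite (XN_sub_lam cE); congr (_ ^+ _).
  have E i : f i = 'X^(2 * l ^ (m - z)) -
      ((c^-1 ^+ (2 * l ^ (m - z)) * xi ^+ y) * delta ^+ i)%:P.
    by rewrite /f -exprVn mulrAC.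
  rewrite (eq_bigr _ (fun i _ => E i)).
  rewrite (prod_subC_prim_root _ (prim_root_div (ltnW logn_index_lt))); last first.
    by rewrite mulf_neq0 ?expf_neq0.
  by rewrite exprMn -!exprM -mulnA -expn_split_logn_index -index_factorE.
rewrite /f; apply: irreducible_X2ln_subC => [|b|_ b].
- by rewrite !mulf_neq0 ?expf_neq0 // -exprVn expf_neq0.
- rewrite -exprVn [(2 * _)%N]mulnC exprM -mulrA /delta -[xi ^+ _ ^+ i]exprM -exprD.
  apply: prim_exp_nonpower; rewrite ?pred_card_even ?expf_neq0 //.
  by rewrite dvdn2 oddD oddM odd_y (negPf (even_pred_card_div (ltnW logn_index_lt))).
by rewrite -exprVn exprM; apply: delta_exp_nonpower; rewrite ?index_cofactor_ndvd ?expf_neq0.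
Qed.

(** For even y the constant is a square. The difference of squares gives the same binomial for 1/c
    and -1/c, and each is split by [delta]. *)
Lemma code_caseIIIB : ~~ odd y ->
  exists eps eps' : nat -> nat,
    [/\ forall i, (eps i <= p ^ n)%N, forall i, (eps' i <= p ^ n)%N
      & code_generated lam C (genIIIB l m z y./2 c delta xi eps eps')].
Proof.
move=> even_y; have c0 := length_root_inv_neq0; have xi0 := prim_root_neq0 prim_xi.
have yE : y = (y./2 * 2)%N by rewrite muln2 -[LHS]odd_double_half (negPf even_y).
have ly : ~~ (l %| y./2)%N by apply: contra index_cofactor_ndvd => ly; rewrite yE dvdn_mulr.
pose g (e : F) i := 'X^(l ^ (m - z)) - (e ^+ (l ^ (m - z)) * delta ^+ i * xi ^+ y./2)%:P.
have g_irr e i : e != 0 -> irreducible_poly (g e i).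
  move=> e0; apply: irreducible_Xln_subC => [|_ b]; last exact: delta_exp_nonpower.
  by rewrite !mulf_neq0 ?expf_neq0.
have g_prod e : e != 0 -> \prod_(0 <= i < l ^ z) g e i =
    'X^(l ^ m) - (e ^+ (l ^ m) * xi ^+ (y./2 * l ^ z))%:P.
  move=> e0; have E i : g e i = 'X^(l ^ (m - z)) -
      ((e ^+ (l ^ (m - z)) * xi ^+ y./2) * delta ^+ i)%:P by rewrite /g mulrAC.
  rewrite (eq_bigr _ (fun i _ => E i)).
  rewrite (prod_subC_prim_root _ (prim_root_div (ltnW logn_index_lt))); last first.
    by rewrite mulf_neq0 ?expf_neq0.
  by rewrite exprMn -!exprM -expn_split_logn_index.
have oddN k : (- c^-1) ^+ (l ^ k) = - (c^-1 ^+ (l ^ k)).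
  by rewrite exprNn -signr_odd oddX odd_l orbT expr1 mulN1r.
pose K := (p ^ n)%N.
have cN0 : - c^-1 != 0 by rewrite oppr_eq0.
have AE : 'X^N - lam%:P = \prod_(0 <= i < l ^ z) (g c^-1 i ^+ K * g (- c^-1) i ^+ K).
  rewrite prod_expr_pair !g_prod // -exprMn (XN_sub_lam cE) oddN mulNr polyCN opprK.
  rewrite -subr_sqr -polyC_exp exprMn -!exprM [(l ^ m * 2)%N]mulnC {1}index_factorE {1}yE.
  by rewrite mulnAC.
have D := divisors_param_prod (P := xpredT) (t0 := (0, 0)%N) (iota_uniq 0 (l ^ z - 0))
  (conj (leq0n K) (leq0n K))
  (fun i _ _ => divisors_param_pair K (g_irr _ i c0) (g_irr _ i cN0)).
have [t ok_t Ct] := code_generated_param AE D.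
exists (fun i => (t i).1), (fun i => (t i).2); split.
- by move=> i; have [] := ok_t i.
- by move=> i; have [] := ok_t i.
congr code_generated: Ct; rewrite /genIIIB big_mkord.
by apply: eq_bigr => i _; rewrite /g oddN !mulNr polyCN opprK -exprVn.
Qed.

End CaseIII.
End Codes.
End ConstacyclicCodesOfLength2lmpn.

Theorem theorem3p3 (F : finFieldType) (p l m n : nat) (xi lam : F)
  (C : {vspace 'rV[F]_(2 * l ^ m * p ^ n)}) :
  prime p -> odd p -> p \in [pchar F] ->
  (#|F|.-1).-primitive_root xi ->
  prime l -> odd l -> l != p -> (l %| #|F|.-1)%N ->
  (0 < m)%N -> (0 < n)%N ->
  lam != 0 -> is_constacyclic lam C ->
  let q := #|F| in
  let u := logn l q.-1 in
  let v := minn m u in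
  let N := (2 * l ^ m * p ^ n)%N in
  let zeta := xi ^+ (q.-1 %/ l ^ v) in
  [\/
    (* (I) *)
    [/\ in_coset xi 0 (2 * l ^ v) lam,
        exists c1 : F, c1 != 0 /\ c1 ^+ N * lam = 1
      & forall c1 : F, c1 ^+ N * lam = 1 ->
          exists (eps eps' : nat -> nat) (tau sig : nat -> nat -> nat),
            [/\ forall i, (eps i <= p ^ n)%N, forall i, (eps' i <= p ^ n)%N,
                forall j k, (tau j k <= p ^ n)%N, forall j k, (sig j k <= p ^ n)%N
              & code_generated lam C (genI l v m u c1 zeta eps eps' tau sig)]],
    (* (II) *)
    [/\ in_coset xi (l ^ v * p ^ n) (2 * l ^ v) lam,
        exists c2 : F, c2 != 0 /\ c2 ^+ N * lam = xi ^+ (l ^ v * p ^ n)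
      & forall c2 : F, c2 ^+ N * lam = xi ^+ (l ^ v * p ^ n) ->
          (* (II.A) *)
          ((m <= u)%N ->
             let alpha := xi ^+ (q.-1 %/ l ^ m) in
             exists eps : nat -> nat,
               (forall i, (eps i <= p ^ n)%N) /\
               code_generated lam C (genIIA l m c2 xi alpha eps)) /\
          (* (II.B) *)
          ((u < m)%N ->
             forall beta : F, (exists t : nat, beta = xi ^+ (l ^ u * t)) ->
               beta ^+ (l ^ m) * xi ^+ (l ^ u) = 1 ->
             exists (eps : nat -> nat) (sig : nat -> nat -> nat),
               [/\ forall i, (eps i <= p ^ n)%N, forall j k, (sig j k <= p ^ n)%N
                 & code_generated lam C (genIIB l m u c2 beta zeta eps sig)])]
  | (* (III) *)
    exists j : nat,
      [/\ (1 <= j <= 2 * l ^ v - 1)%N, j != (l ^ v)%N,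
          in_coset xi (j * p ^ n) (2 * l ^ v) lam,
          exists d1 : F, d1 != 0 /\ d1 ^+ N * lam = xi ^+ (j * p ^ n)
        & forall d1 : F, d1 ^+ N * lam = xi ^+ (j * p ^ n) ->
            let z := logn l j in
            let y := (j %/ l ^ z)%N in
            let delta := xi ^+ (q.-1 %/ l ^ z) in
            (* (III.A) *)
            (odd y ->
               exists eps : nat -> nat,
                 (forall i, (eps i <= p ^ n)%N) /\
                 code_generated lam C (genIIIA l m z y d1 delta xi eps)) /\
            (* (III.B), y = 2 y0 *)
            (~~ odd y ->
               exists eps eps' : nat -> nat,
                 [/\ forall i, (eps i <= p ^ n)%N, forall i, (eps' i <= p ^ n)%N
                   & code_generated lam C (genIIIB l m z y./2 d1 delta xi eps eps')])]
  ].
Proof.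
move=> p_pr odd_p char_p prim_xi l_pr odd_l l_neq_p l_dvd m_gt0 n_gt0 lam0 C_cyc.
move=> q u v N zeta.
(* The coset index j decides the case: j = 0 gives I, j = l^v gives II, all others III. *)
have [j j_lt j_coset] :=
  exists_coset m n p_pr odd_p char_p prim_xi l_pr odd_l lam0.
have root s : in_coset xi s (2 * l ^ v) lam ->
    exists c : F, c != 0 /\ c ^+ N * lam = xi ^+ s.
  exact: exists_length_root.
have [j0|j_gt0] := posnP j.
  rewrite j0 mul0n in j_coset; apply: Or31; split=> //.
    by have [c [c0 cE]] := root _ j_coset; exists c.
  by move=> c; apply: code_caseI.
have [jlv|j_neq] := eqVneq j (l ^ v)%N.
  rewrite jlv in j_coset; apply: Or32; split=> // [|c cE]; first exact: root.
  split=> [mu alpha|um beta [t betaE] beta_m]; first exact: code_caseIIA.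
  exact: code_caseIIB betaE beta_m.
have j_bounds : (1 <= j <= 2 * l ^ v - 1)%N.
  by rewrite j_gt0 subn1 -ltnS (ltn_predK j_lt).
apply: Or33; exists j; split=> // [|d dE z y delta]; first exact: root.
by split; [apply: code_caseIIIA | apply: code_caseIIIB].
Qed.
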